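(* Let $q$ be a prime power with $q\equiv\pm1\pmod 8$, let $G=\mathrm{PSL}(2,q)$, let $H$ be a subgroup of $G$ and $Q$ a Sylow $2$-subgroup of $H$. Then $H$ is a perfect code of $G$ if and only if one of the following holds: (i) $Q$ is trivial; (ii) $Q$ is noncyclic; (iii) $Q$ is cyclic and its order equals the largest order of a cyclic $2$-subgroup of $G$.
   Context: All graphs are finite, undirected and simple. A subset $C$ of the vertex set of a graph $\Gamma$ is a perfect code in $\Gamma$ if no two vertices of $C$ are adjacent and every vertex not in $C$ is adjacent to exactly one vertex of $C$. For a finite group $K$ and a subset $S\subseteq K$ with $S^{-1}=S$ and $1\notin S$, the Cayley graph $\mathrm{Cay}(K,S)$ has vertex set $K$, with $x,y$ adjacent iff $yx^{-1}\in S$. A subset $C$ of $K$ is called a perfect code of $K$ if there exists such an $S$ for which $C$ is a perfect code in $\mathrm{Cay}(K,S)$. $\mathrm{PSL}(2,q)$ denotes the projective special linear group of degree $2$ over the field with $q$ elements. *)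

(* Defs.v *)
From mathcomp Require Import all_boot all_order all_fingroup all_algebra all_solvable.

Set Implicit Arguments.
Unset Strict Implicit.
Unset Printing Implicit Defensive.

Import GroupScope GRing.Theory.

(* A graph is given by its vertex set V and an adjacency relation e. *)
Definition perfect_code_in (T : finType) (V : {set T}) (e : rel T)
    (C : {set T}) : Prop :=
  [/\ C \subset V,
      {in C &, forall x y, ~~ e x y}
    & {in V :\: C, forall y, #|[set x in C | e y x]| = 1%N}].

Definition cayley_adj (gT : finGroupType) (S : {set gT}) : rel gT :=
  fun x y => y * x^-1 \in S.

Definition perfect_code (gT : finGroupType) (K : {group gT})
    (C : {set gT}) : Prop :=
  exists S : {set gT},
    [/\ S \subset K, S^-1 = S, 1 \notin S
      & perfect_code_in K (cayley_adj S) C].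

Section ProjectiveSpecialLinear.

Variable F : finFieldType.

Definition SL2_set : {set {'GL_2[F]}} :=
  [set u | (\det (GLval u) == 1)%R].

Lemma SL2_group_set : group_set SL2_set.
Proof.
apply/group_setP; split=> [|u v]; first by rewrite inE GL_1E det1.
by rewrite !inE GL_ME det_mulmx => /eqP-> /eqP->; rewrite mulr1.
Qed.

Definition SL2 : {group {'GL_2[F]}} := Group SL2_group_set.

Definition PSL2 : {group coset_of 'Z(SL2)} := (SL2 / 'Z(SL2))%G.

End ProjectiveSpecialLinear.

Definition max_cyclic_2subgroup_order (gT : finGroupType)
    (G : {group gT}) : nat :=
  \max_(C : {group gT} | [&& C \subset G, 2.-group C & cyclic C]) #|C|.

(* Main.v *)
(* By Sylow's theorem and counting in double cosets, H is a perfect code of G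
   iff every x in N_G(Q) with x^2 in Q has an element of square 1 in Q x: a
   perfect code amounts to an inverse-closed transversal of the right cosets of
   H, the only obstruction to which is a self-inverse double coset made of an
   odd number of right cosets and containing no element of square 1.  In
   PSL(2,q) a central involution z of a 2-subgroup R lifts to a matrix A with
   A^2 = -1; an element of R lifts to a matrix B with BA = AB or BA = -AB, and
   in the second case B^2 = -1.  So every element of R has square 1 outside a
   subgroup that is abelian with a unique involution, hence cyclic.  Finally
   (1 + A) / sqrt 2 is a square root of A, and 2 is a square in F because
   q = +-1 mod 8; hence cyclic 2-subgroups of non-maximal order are generated
   by squares, and these are the ones that violate the criterion. *)
Require Import Defs.
From mathcomp Require Import all_boot all_order all_fingroup all_algebra all_solvable.
From mathcomp Require Import all_field ring.

Set Implicit Arguments.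
Unset Strict Implicit.
Unset Printing Implicit Defensive.

Import GroupScope.

(** * Perfect codes and inverse-closed transversals *)

Section PerfectCodes.

Variable gT : finGroupType.
Implicit Types (G H Q : {group gT}) (S T D : {set gT}) (s t x y : gT).

(** An element distinct from its inverse can be removed together with that inverse, which preserves
    both closure under inversion and parity; an odd set is never exhausted in this way. *)
Lemma odd_invg_closed_fix S :
  S^-1 = S -> odd #|S| -> exists2 t, t \in S & t * t = 1.
Proof.
have [n] := ubnP #|S|; elim: n S => // n IHn S ltSn SV oddS.
have /card_gt0P[x Sx]: #|S| > 0 by case: #|S| oddS.
have SxV: x^-1 \in S by rewrite -SV inE invgK.
have [xV | xxV] := eqVneq x x^-1; first by exists x; rewrite // {2}xV mulgV.
have xVx: x^-1 \in S :\ x by rewrite !inE eq_sym xxV.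
have cardS: #|S| = #|S :\ x :\ x^-1|.+2.
  by rewrite (cardsD1 x) Sx (cardsD1 x^-1 (S :\ x)) xVx.
have [|||t] := IHn (S :\ x :\ x^-1).
- by move: ltSn; rewrite cardS !ltnS => /ltnW.
- apply/setP=> y; rewrite !inE (inj_eq invg_inj) eq_invg_sym andbCA.
  by rewrite -{1}SV inE invgK.
- by move: oddS; rewrite cardS /= negbK.
by rewrite !inE => /and3P[_ _ St] tt; exists t.
Qed.

(** The map [x |-> x * y^-1] sends the neighbours of [y] in [H] onto [S :&: H :* y^-1], so adjacency
    conditions become coset conditions. Adjoining [1] to [S] supplies the representative of [H]
    itself; conversely, [T :\: H] discards it. *)
Lemma perfect_code_groupP G H : H \subset G ->
  perfect_code G H <->
  exists T, [/\ T \subset G, T^-1 = T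
              & {in G, forall y, #|T :&: H :* y| = 1%N}].
Proof.
move=> sHG.
have cardE S y : #|[set x in H | cayley_adj S y x]| = #|S :&: H :* y^-1|.
  rewrite -(card_rcoset _ y); apply: eq_card => x.
  by rewrite mem_rcoset !inE mem_rcoset invgK mulgKV andbC.
split=> [[S [sSG SV S'1 [_ nadj adj1]]] | [T [sTG TV T1]]].
  have SH x : x \in H -> x \notin S.
    by move=> Hx; have:= nadj 1 x (group1 H) Hx; rewrite /cayley_adj invg1 mulg1.
  exists (1 |: S); split.
  - by rewrite subUset sub1set group1.
  - by rewrite invUg SV; congr (_ :|: _); apply/setP=> x; rewrite !inE invg_eq1.
  move=> y Gy; have [Hy | H'y] := boolP (y \in H).
    rewrite rcoset_id // -(cards1 (1 : gT)); apply: eq_card => x.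
    rewrite !inE; have [-> | _] /= := eqVneq x 1; first exact: group1.
    by apply/andP=> -[Sx /SH]; rewrite Sx.
  have:= adj1 y^-1; rewrite !inE !groupV H'y Gy cardE invgK => /(_ isT) <-.
  apply: eq_card => x; rewrite !inE mem_rcoset.
  have [-> | //] := eqVneq x 1; rewrite (negPf S'1) /= mul1g groupV.
  exact: negPf.
exists (T :\: H); split.
- by rewrite subDset subsetU ?sTG ?orbT.
- by apply/setP=> x; rewrite !inE groupV -{2}TV inE.
- by rewrite !inE group1.
split=> // [x y Hx Hy | y /setDP[Gy H'y]].
  by rewrite /cayley_adj !inE groupM ?groupV.
rewrite cardE -(T1 y^-1) ?groupV //; apply: eq_card => x.
rewrite !inE mem_rcoset invgK; case Hxy: (x * y \in H); last by rewrite !andbF.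
case Hx: (x \in H) => //=; case/negP: H'y.
by rewrite groupMl in Hxy.
Qed.

(** * Partial transversals closed under inversion *)

Definition coset_inj H S := {in S &, forall s t, s * t^-1 \in H -> s = t}.

Lemma card_mul_coset_inj H S : coset_inj H S -> #|H * S| = (#|H| * #|S|)%N.
Proof.
move=> injS; have ->: H * S = uncurry mulg @: setX H S.
  apply/setP=> x; apply/mulsgP/imsetP=> [[h s Hh Ss ->] | [[h s] /setXP[Hh Ss] ->]].
    by exists (h, s); rewrite // inE Hh.
  by exists h s.
rewrite card_in_imset ?cardsX //.
move=> [h s] [k t] /setXP[/= Hh Ss] /setXP[/= Hk St] eq_hs.
have est: s = t.
  apply: injS => //; suff ->: s * t^-1 = h^-1 * k by rewrite groupM ?groupV.
  by apply: (mulgI h); rewrite mulgA eq_hs mulgK mulKVg.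
by move: eq_hs; rewrite est => /mulIg->.
Qed.

(** Boolean, so that one of maximal size can be selected with [arg_maxnP]. *)
Definition sym_partial_transversal G H S :=
  [&& S \subset G, S^-1 == S
    & [forall s in S, forall t in S, (s * t^-1 \in H) ==> (s == t)]].

Lemma sym_partial_transversalP G H S :
  reflect [/\ S \subset G, S^-1 = S & coset_inj H S]
          (sym_partial_transversal G H S).
Proof.
apply: (iffP and3P) => [] [sSG SV injS]; split=> //; try exact/eqP.
  move=> s t Ss St Hst; apply/eqP.
  by move/forall_inP/(_ s Ss)/forall_inP/(_ t St)/implyP: injS => ->.
by apply/forall_inP=> s Ss; apply/forall_inP=> t St; apply/implyP=> /injS->.
Qed.

Lemma sym_partial_transversalD G H S T : T^-1 = T ->
  sym_partial_transversal G H S -> sym_partial_transversal G H (S :\: T).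
Proof.
move=> TV /sym_partial_transversalP[sSG SV injS].
apply/sym_partial_transversalP; split.
- exact: subset_trans (subsetDl S T) sSG.
- by apply/setP=> x; rewrite !inE -{2}SV -{2}TV !inE.
by move=> s t /setDP[Ss _] /setDP[St _]; apply: injS.
Qed.

Lemma sym_partial_transversalU G H S T :
    sym_partial_transversal G H S -> sym_partial_transversal G H T ->
    {in S & T, forall s t, s * t^-1 \notin H} ->
  sym_partial_transversal G H (S :|: T) /\ #|S :|: T| = (#|S| + #|T|)%N.
Proof.
move=> /sym_partial_transversalP[sSG SV injS].
move=> /sym_partial_transversalP[sTG TV injT] nST; split; last first.
  rewrite cardsU disjoint_setI0 ?cards0 ?subn0 //.
  apply/pred0P=> s /=; apply/andP=> -[Ss Ts].
  by have:= nST s s Ss Ts; rewrite mulgV group1.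
apply/sym_partial_transversalP; split.
- by rewrite subUset sSG.
- by rewrite invUg SV TV.
move=> s t /setUP[] Us /setUP[] Ut; [exact: injS | | | exact: injT].
  by rewrite (negPf (nST s t Us Ut)).
by rewrite -groupV invMg invgK (negPf (nST t s Ut Us)).
Qed.

(** * Double cosets *)

Lemma double_cosetP H x y :
  reflect (exists h k, [/\ h \in H, k \in H & x = h * y * k])
          (x \in H :* y * H).
Proof.
apply: (iffP mulsgP) => [[_ k /rcosetP[h Hh ->] Hk ->] | [h [k [Hh Hk ->]]]].
  by exists h, k.
by exists (h * y) k; rewrite // mem_rcoset mulgK.
Qed.

Lemma double_coset_refl H y : y \in H :* y * H.
Proof. by apply/double_cosetP; exists 1, 1; rewrite mulg1 mul1g group1. Qed.

Lemma double_coset_mull H h x y :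
  h \in H -> (h * x \in H :* y * H) = (x \in H :* y * H).
Proof.
move=> Hh; have DM g z : g \in H -> z \in H :* y * H -> g * z \in H :* y * H.
  move=> Hg /double_cosetP[k [l [Hk Hl ->]]]; apply/double_cosetP.
  by exists (g * k), l; rewrite groupM // !mulgA.
by apply/idP/idP=> [Dhx | /DM->//]; rewrite -(mulKg h x) DM ?groupV.
Qed.

Lemma double_coset_mulr H h x y :
  h \in H -> (x * h \in H :* y * H) = (x \in H :* y * H).
Proof.
move=> Hh; have DM g z : g \in H -> z \in H :* y * H -> z * g \in H :* y * H.
  move=> Hg /double_cosetP[k [l [Hk Hl ->]]]; apply/double_cosetP.
  by exists k, (l * g); rewrite groupM // !mulgA.
by apply/idP/idP=> [Dhx | /DM->//]; rewrite -(mulgK h x) DM ?groupV.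
Qed.

Lemma double_coset_sym H x y :
  (x \in H :* y * H) = (y \in H :* x * H).
Proof.
suff D_sym z w : z \in H :* w * H -> w \in H :* z * H.
  by apply/idP/idP; apply: D_sym.
case/double_cosetP=> [h [k [Hh Hk ->]]].
apply/double_cosetP; exists h^-1, k^-1.
by rewrite !groupV -!mulgA mulKg mulgV mulg1.
Qed.

Lemma double_coset_trans H x y z :
  x \in H :* y * H -> y \in H :* z * H -> x \in H :* z * H.
Proof.
case/double_cosetP=> [h [k [Hh Hk ->]]] Dy.
by rewrite double_coset_mulr ?double_coset_mull.
Qed.

Lemma double_coset_eq H x y : x \in H :* y * H -> H :* x * H = H :* y * H.
Proof.
move=> Dx; apply/setP=> z; apply/idP/idP=> Dz; apply: double_coset_trans Dz _ => //.
by rewrite double_coset_sym.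
Qed.

Lemma double_coset_inv H y : (H :* y * H)^-1 = H :* y^-1 * H.
Proof. by rewrite !invMg !invGid invg_set1 mulgA. Qed.

Lemma double_coset_sub G H y : H \subset G -> y \in G -> H :* y * H \subset G.
Proof. by move=> sHG Gy; rewrite !mul_subG ?sub1set. Qed.

Lemma mul_sub_double_coset H y S :
  S \subset H :* y * H -> H * S \subset H :* y * H.
Proof.
move=> sSD; apply/subsetP=> _ /mulsgP[h s Hh Ss ->].
by rewrite double_coset_mull ?(subsetP sSD).
Qed.

(** This is what allows two right cosets to be represented by a pair of mutually inverse
    elements. *)
Lemma double_coset_link H a b : b^-1 \in H :* a * H ->
  exists2 s, s \in H :* a & s^-1 \in H :* b.
Proof.
case/double_cosetP=> [h [k [Hh Hk bV]]]; exists (h * a).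
  by rewrite mem_rcoset mulgK.
have ->: h * a = b^-1 * k^-1 by rewrite bV mulgK.
by rewrite invMg !invgK mem_rcoset mulgK.
Qed.

(** * Enlarging a partial transversal *)

Lemma sym_partial_transversal1 G H t : t \in G -> t * t = 1 ->
  sym_partial_transversal G H [set t].
Proof.
move=> Gt tt; apply/sym_partial_transversalP; split; first by rewrite sub1set.
  by rewrite invg_set1; congr [set _]; apply/eqP; rewrite eq_invg_mul tt.
by move=> x y /set1P-> /set1P->.
Qed.

(** The set added to [S] is [[set s; s^-1]] with [s] in [H :* a] and [s^-1] in [H :* b]. The two
    cosets differ, hence [s * s] is not in [H] and the pair really has two elements. *)
Lemma sym_partial_transversal_pair G H S a b :
    sym_partial_transversal G H S -> H \subset G -> a \in G ->
    {in S, forall s, s * a^-1 \notin H} -> {in S, forall s, s * b^-1 \notin H} ->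
    a * b^-1 \notin H -> b^-1 \in H :* a * H ->
  exists2 T, sym_partial_transversal G H T & #|T| = #|S|.+2.
Proof.
move=> ptS sHG Ga nSa nSb nab /double_coset_link[s /rcosetP[h Hh s_ha]].
case/rcosetP=> k Hk sV_kb; have ss: s * s \notin H.
  have ->: s * s = h * (a * b^-1) * k^-1.
    by rewrite !mulgA -s_ha -[X in _ * X]invgK sV_kb invMg mulgA.
  by rewrite groupMr ?groupV // groupMl.
have sV: s != s^-1.
  by apply: contraNneq ss => sV; rewrite {2}sV mulgV group1.
have [] := @sym_partial_transversalU G H S [set s; s^-1] ptS.
- apply/sym_partial_transversalP; split.
  + by rewrite subUset !sub1set groupV s_ha groupM // (subsetP sHG).
  + by rewrite invUg !invg_set1 invgK setUC.
  move=> x y /set2P[] -> /set2P[] ->; rewrite ?invgK // => Hxx.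
    by rewrite Hxx in ss.
  by rewrite -invMg groupV (negPf ss) in Hxx.
- move=> x y Sx /set2P[] ->.
    by rewrite s_ha invMg mulgA groupMr ?groupV ?nSa.
  by rewrite sV_kb invMg mulgA groupMr ?groupV ?nSb.
move=> ptT cardT; exists (S :|: [set s; s^-1]) => //.
by rewrite cardT cards2 sV addn2.
Qed.

(** A symmetric partial transversal [S] of maximal size is complete: if it missed a coset [H :* y],
    maximality would force [S] to meet every other coset of the double coset of [y], and a local
    exchange there would enlarge [S]. *)
Lemma sym_transversal_exists G H : H \subset G ->
    {in G, forall y, y^-1 \in H :* y * H -> odd (#|H :* y * H| %/ #|H|) ->
       exists2 t, t \in H :* y * H & t * t = 1} ->
  exists T, [/\ T \subset G, T^-1 = T
              & {in G, forall y, #|T :&: H :* y| = 1%N}].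
Proof.
move=> sHG fixD; pose pt := sym_partial_transversal G H.
have pt0: pt set0.
  by apply/sym_partial_transversalP; split=> [||x]; rewrite ?sub0set ?inE //;
     apply/setP=> x; rewrite !inE.
have [S ptS maxS]: exists2 S, pt S & forall T, pt T -> #|T| <= #|S|.
  by case: (arg_maxnP (fun S : {set gT} => #|S|) pt0) => S; exists S.
have /sym_partial_transversalP[sSG SV injS] := ptS.
have SVm s : (s^-1 \in S) = (s \in S) by rewrite -{2}SV inE.
exists S; split=> // y Gy.
have [/exists_inP[s Ss Hsy] | nSy] := boolP [exists s in S, s * y^-1 \in H].
  rewrite -(cards1 s); apply: eq_card => x; rewrite !inE mem_rcoset.
  apply/andP/eqP=> [[Sx Hxy] | -> //].
  apply: injS => //; have ->: x * s^-1 = (x * y^-1) * (s * y^-1)^-1.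
    by rewrite invMg invgK mulgA mulgKV.
  by rewrite groupM ?groupV.
have {}nSy: {in S, forall s, s * y^-1 \notin H}.
  by move=> s Ss; apply: contraNN nSy => Hsy; apply/exists_inP; exists s.
have notpt T : pt T -> #|T| = #|S|.+1 -> False.
  by move/maxS=> leTS eqT; rewrite eqT ltnn in leTS.
exfalso; set D := H :* y * H in fixD *; pose DS := D :&: S.
(* A second missed coset [H :* b] could be linked with [H :* y] by an inverse pair, against
   maximality. *)
have hit b : b \in G -> b^-1 \in D -> b * y^-1 \in H \/ b \in H * S.
  move=> Gb Db; have [Hby | H'by] := boolP (b * y^-1 \in H); [by left | right].
  apply: contraT => nSb.
  have [||T ptT cardT] := sym_partial_transversal_pair ptS sHG Gy nSy _ _ Db.
  - move=> s Ss; apply: contra nSb => Hsb.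
    have ->: b = (s * b^-1)^-1 * s by rewrite invMg invgK mulgKV.
    by rewrite mem_mulg ?groupV.
  - by rewrite -groupV invMg invgK.
  by have:= maxS T ptT; rewrite cardT -ltnS ltnNge leqnSn.
have sDG: D \subset G by apply: double_coset_sub.
have HS' z : z \in H * S -> z * y^-1 \notin H.
  by case/mulsgP=> h s Hh Ss ->; rewrite -mulgA groupMl ?nSy.
have sHDS: H * DS \subset D by rewrite mul_sub_double_coset ?subsetIl.
have cardHDS: #|H * DS| = (#|H| * #|DS|)%N.
  by apply: card_mul_coset_inj => s t /setIP[_ Ss] /setIP[_ St]; apply: injS.
(* If [D] were not closed under inversion, [S] would meet every right coset in [D^-1]; inverting
   those representatives gives equally many in [D], although [H :* y] has none. *)
have DyV: y^-1 \in D.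
  apply: contraT => D'yV; suff: #|D^-1| <= #|H * DS|.
    rewrite card_invg leqNgt; case/negP; apply: proper_card.
    rewrite properE sHDS; apply/subsetPn; exists y; first exact: double_coset_refl.
    apply/negP=> /(subsetP (mulgS H (subsetIr D S)))/HS'.
    by rewrite mulgV group1.
  rewrite cardHDS -(card_invg DS) -card_mul_coset_inj.
    apply: subset_leq_card; apply/subsetP=> b; rewrite inE => Db.
    have Gb: b \in G by rewrite -groupV (subsetP sDG).
    have [Hby | /mulsgP[h s Hh Ss def_b]] := hit b Gb Db.
      case/negP: D'yV; rewrite -[y^-1](mulKg b).
      by rewrite double_coset_mulr.
    rewrite def_b mem_mulg // !inE SVm Ss andbT.
    by move: Db; rewrite def_b invMg double_coset_mulr ?groupV.
  move=> s t; rewrite !(inE, SVm) => /andP[_ Ss] /andP[_ St].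
  exact: injS.
have DV b : b \in D -> b^-1 \in D.
  move=> Db; suff: b \in D^-1 by rewrite inE.
  rewrite double_coset_inv; apply: double_coset_trans Db _.
  by rewrite double_coset_sym.
have coverD b : b \in D -> b * y^-1 \in H \/ exists2 s, s \in DS & b * s^-1 \in H.
  move=> Db; case: (hit b (subsetP sDG b Db) (DV b Db)); first by left.
  case/mulsgP=> h s Hh Ss def_b; right; exists s; last by rewrite def_b mulgK.
  by rewrite inE Ss andbT -(mulKg h s) -def_b double_coset_mull ?groupV.
have cardD: #|D| = (#|H| * #|DS|.+1)%N.
  have ->: D = H * DS :|: H :* y.
    apply/eqP; rewrite eqEsubset subUset sHDS /=; apply/andP; split; last first.
      apply/subsetP=> _ /rcosetP[h Hh ->].
      by rewrite double_coset_mull ?double_coset_refl.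
    apply/subsetP=> b Db; rewrite inE mem_rcoset orbC.
    have [-> // | [s DSs Hbs]] := coverD b Db.
    by rewrite -[b](mulgKV s) mem_mulg ?orbT.
  rewrite cardsU disjoint_setI0 ?cards0 ?subn0 ?cardHDS ?card_rcoset ?mulnS.
    by rewrite addnC.
  apply/pred0P=> z /=; apply/andP=> -[HSz]; rewrite mem_rcoset; apply/negP/HS'.
  exact: subsetP (mulgS H (subsetIr D S)) z HSz.
(* [D] consists of [#|DS| + 1] right cosets. If [#|DS|] is odd, the inverse-closed [DS] already
   contains [t]; if it is even, [fixD] applies. *)
have [t Dt tt]: exists2 t, t \in D & t * t = 1.
  case oddDS: (odd #|DS|).
    have [|t /setIP[Dt _] tt] := odd_invg_closed_fix _ oddDS; last by exists t.
    apply/setP=> z; rewrite !inE SVm; case: (z \in S); rewrite ?andbF // !andbT.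
    by apply/idP/idP=> /DV; rewrite ?invgK.
  by apply: fixD => //; rewrite cardD mulKn ?cardG_gt0 //= oddDS.
have Gt := subsetP sDG t Dt.
have [Hty | [s /setIP[Ds Ss] Hts]] := coverD t Dt.
  have [|ptT cardT] := sym_partial_transversalU ptS (sym_partial_transversal1 H Gt tt).
    move=> s _ Ss /set1P->; apply: contra (nSy s Ss) => Hst.
    by rewrite -[s](mulgKV t) -mulgA groupM.
  by apply: (notpt _ ptT); rewrite cardT cards1 addn1.
(* When [s] is its own inverse, it is traded for an inverse pair representing [H :* y] and
   [H :* s]. *)
have [ss | ss] := eqVneq s s^-1.
  have ptS1 : pt (S :\ s).
    by apply: sym_partial_transversalD; rewrite // invg_set1 -ss.
  have [||||T ptT cardT] := sym_partial_transversal_pair (b := s) ptS1 sHG Gy.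
  - by move=> r /setD1P[_ Sr]; apply: nSy.
  - move=> r /setD1P[r's Sr]; apply: contra r's => Hrs.
    by apply/eqP/injS.
  - by rewrite -groupV invMg invgK nSy.
  - exact: DV.
  by apply: (notpt T ptT); rewrite cardT (cardsD1 s S) Ss.
(* Otherwise [s] and [s^-1] are both removed: [t] takes over [H :* s], and an inverse pair
   represents [H :* y] and [H :* s^-1], a net gain of one. *)
pose E := [set s; s^-1]; pose S1 := S :\: E.
have ptS1 : pt S1.
  by apply: sym_partial_transversalD; rewrite // invUg !invg_set1 invgK setUC.
have cardS1: #|S| = #|S1|.+2.
  rewrite -(cardsID E S) (setIidPr _) ?cards2 ?ss //.
  by rewrite subUset !sub1set SVm Ss.
have [|ptS2 cardS2] := sym_partial_transversalU ptS1 (sym_partial_transversal1 H Gt tt).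
  move=> r _ /setDP[Sr E'r] /set1P->; apply: contra E'r => Hrt.
  rewrite !inE (injS r s) ?eqxx // -[r](mulgKV t) -mulgA groupM //.
have tV: t^-1 = t by apply/eqP; rewrite eq_invg_mul tt.
have [||||T ptT cardT] := sym_partial_transversal_pair (b := s^-1) ptS2 sHG Gy.
- move=> r /setUP[/setDP[Sr _] | /set1P->]; first exact: nSy.
  apply: contra (nSy s Ss) => Hty.
  by rewrite -[s](mulgKV t) -mulgA groupM // -groupV invMg invgK.
- move=> r /setUP[/setDP[Sr E'r] | /set1P->].
    by apply: contra E'r => /injS->; rewrite ?SVm // !inE eqxx orbT.
  rewrite invgK; apply: contra ss => Hts'.
  apply/eqP; apply: injS; rewrite ?SVm // invgK.
  have ->: s * s = (t * s^-1)^-1 * (t * s).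
    by rewrite invMg invgK -mulgA mulKg.
  by rewrite groupM ?groupV.
- by rewrite -groupV invMg nSy ?SVm.
- by rewrite invgK.
by apply: (notpt T ptT); rewrite cardT cardS2 cards1 addn1 cardS1.
Qed.
(** Left translation by [x^-1] turns the double coset into [H :^ x * H], to which the product
    formula applies. *)
Lemma card_double_coset H x :
  #|H :* x * H| = (#|H| * #|H : H :&: H :^ x|)%N.
Proof.
have K0: 0 < #|H :&: H :^ x| := cardG_gt0 _.
apply/eqP; rewrite -(eqn_pmul2r K0) -mulnA [X in _ == (_ * X)%N]mulnC.
rewrite Lagrange ?subsetIl // -(card_lcoset _ x^-1).
have ->: x^-1 *: (H :* x * H) = H :^ x * H by rewrite conjsgE !mulgA.
by rewrite setIC -mul_cardG cardJg.
Qed.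

(** Both squares being trivial, [x] inverts [c], hence also the square root [k] of [c] that exists
    because [#|G|] is odd. Then [x * c = k^-1 * x * k]. *)
Lemma odd_involution_conj G c x :
    odd #|G| -> c \in G -> x * x = 1 -> (x * c) * (x * c) = 1 ->
  exists2 k, k \in G & (x * c) ^ k = x.
Proof.
move=> oddG Gc xx xcxc; pose k := c ^+ (#|G|.+1)./2.
have kk: k * k = c.
  rewrite -expgD addnn halfK /= oddG subn0 expgS expg_cardG ?mulg1 //.
have xV: x^-1 = x by apply/eqP; rewrite eq_invg_mul xx.
have ckV: k ^ x = k^-1.
  rewrite conjXg -expgVn; congr (_ ^+ _); apply/eqP.
  rewrite eq_sym eq_invg_mul conjgE xV; apply/eqP/(mulgI x).
  by rewrite mulg1 !mulgA -[RHS]mul1g -xcxc !mulgA.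
exists k^-1; first by rewrite groupV groupX.
by rewrite conjgE invgK !mulgA (conjgC k x) ckV -kk !mulgA mulgKV mulgK.
Qed.

End PerfectCodes.

(** * Reduction to a Sylow 2-subgroup *)

Section SylowPerfectCodes.

Variable gT : finGroupType.
Implicit Types (G H K P Q : {group gT}) (S T D : {set gT}) (s t x y : gT).

Lemma index_setIJ_odd H Q x :
  2.-Sylow(H) Q -> x \in 'N(Q) -> odd #|H : H :&: H :^ x|.
Proof.
move=> sylQ nQx; have sQH := pHall_sub sylQ.
rewrite odd_2'nat; apply: pnat_dvd (proj2 (andP (proj2 (andP sylQ)))).
by rewrite indexgS // subsetI sQH -{1}(normP nQx) conjSg.
Qed.

(* Frattini argument: Q and the conjugate of Q by h x are Sylow in
   H :&: H :^ x, hence conjugate there. *)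
Lemma double_coset_norm_Sylow H Q x y :
    2.-Sylow(H) Q -> x \in 'N(Q) -> y \in 'N(Q) -> y \in H :* x * H ->
  y \in 'N_H(Q) :* x * 'N_H(Q).
Proof.
move=> sylQ nQx nQy /double_cosetP[h [k [Hh Hk def_y]]].
pose K := (H :&: H :^ x)%G; have sQH := pHall_sub sylQ.
have sKH: K \subset H by apply: subsetIl.
have sylK: 2.-Sylow(K) Q.
  by apply: pHall_subl sylQ; rewrite // subsetI sQH -{1}(normP nQx) conjSg.
have Qhx: Q :^ (h * x) = Q :^ k^-1.
  by apply: (canRL (conjsgK k)); rewrite -conjsgM -def_y (normP nQy).
have sylK': 2.-Sylow(K) (Q :^ (h * x)).
  apply: (@pHall_subl _ _ H); [| by [] |].
    rewrite /= subsetI {2}conjsgM conjSg Qhx -{1}(conjGid (groupVr Hk)) conjSg sQH.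
    by rewrite -(conjGid Hh) conjSg.
  by rewrite /= Qhx pHallJ ?groupV.
have [n /setIP[Hn /imsetP[m Hm def_n]]] := Sylow_trans sylK' sylK.
rewrite /= -[X in _ = X]conjsgM def_n; set hm := h * m => defQ.
have nQhm: hm \in 'N(Q).
  apply/normP; rewrite -{2}(normP (groupVr nQx)) {2}defQ -conjsgM.
  by congr (_ :^ _); rewrite conjgE /hm !mulgA !mulgK.
have nQk: x^-1 * hm^-1 * y \in 'N(Q) by rewrite !groupM ?groupV.
apply/double_cosetP; exists hm, (x^-1 * hm^-1 * y); split.
- by rewrite inE nQhm groupM.
- rewrite inE nQk andbT def_y (_ : _ * _ = n^-1 * k) ?groupM ?groupV //.
  by rewrite def_n conjgE /hm !invMg invgK !mulgA !mulgKV.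
by rewrite !mulgA mulgK mulgV mul1g.
Qed.

Lemma Sylow2_odd_index H K P :
  K \subset H -> odd #|H : K| -> 2.-Sylow(K) P -> 2.-Sylow(H) P.
Proof.
move=> sKH oddK sylP; rewrite pHallE (subset_trans (pHall_sub sylP)) //=.
rewrite (card_Hall sylP) -(Lagrange sKH) partnM ?cardG_gt0 //.
by rewrite [X in (_ * X)%N]part_p'nat -?odd_2'nat ?muln1.
Qed.

(** By odd index, a Sylow 2-subgroup [P] of [H :&: H :^ y] is Sylow in both [H] and [H :^ y]. It is
    therefore conjugate to [Q] in [H] and to [Q :^ y] in [H :^ y]; the two conjugators correct [y]
    to an element normalising [Q]. *)
Lemma double_coset_meet_norm_Sylow H Q y :
    2.-Sylow(H) Q -> odd #|H : H :&: H :^ y| ->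
  exists2 x, x \in 'N(Q) & x \in H :* y * H.
Proof.
move=> sylQ oddK; pose K := (H :&: H :^ y)%G.
have [P sylP] := Sylow_exists 2 K; have sPK := pHall_sub sylP.
have sylPH := Sylow2_odd_index (subsetIl _ _) oddK sylP.
have cardP: #|P| = (#|H|`_2)%N := card_Hall sylPH.
have sPHy : P \subset H :^ y := subset_trans sPK (subsetIr _ _).
have sylPHy : 2.-Sylow(H :^ y) P.
  by rewrite pHallE sPHy cardP cardJg /=.
have sylQy : 2.-Sylow(H :^ y) (Q :^ y) by rewrite pHallJ2.
have [_ /imsetP[h Hh ->] defP] := Sylow_trans sylQy sylPHy.
have [k Hk defP'] := Sylow_trans sylQ sylPH.
exists (h * y * k^-1).
  apply/normP; rewrite conjsgM; apply: (canLR (conjsgK k)).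
  rewrite -defP' defP /= -conjsgM; congr (_ :^ _).
  by rewrite conjgE !mulgA mulgV mul1g.
by apply/double_cosetP; exists h, k^-1; rewrite groupV.
Qed.

Lemma odd_norm_Sylow_quotient H Q : 2.-Sylow(H) Q -> odd #|'N_H(Q) / Q|.
Proof.
move=> sylQ; have sQH := pHall_sub sylQ.
rewrite card_quotient ?subsetIr // odd_2'nat.
apply: pnat_dvd (proj2 (andP (proj2 (andP sylQ)))).
by rewrite indexSg ?subsetIl // subsetI sQH normG.
Qed.

(** After [y] is replaced by a representative [x] normalising [Q], the question descends to the
    double coset of [x] modulo [Q], with respect to the odd group ['N_H(Q) / Q]. It is
    inverse-closed of odd size, so it has an element of square 1, whose lift [z] satisfies the
    premise of [liftQ]. *)
Lemma double_coset_involution G H Q y :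
    H \subset G -> 2.-Sylow(H) Q ->
    {in 'N_G(Q), forall x, x * x \in Q -> exists2 t, t \in Q :* x & t * t = 1} ->
    y \in G -> y^-1 \in H :* y * H -> odd (#|H :* y * H| %/ #|H|) ->
  exists2 t, t \in H :* y * H & t * t = 1.
Proof.
move=> sHG sylQ liftQ Gy DyV; rewrite card_double_coset mulKn ?cardG_gt0 //.
case/(double_coset_meet_norm_Sylow sylQ)=> x nQx Dx.
pose M := 'N_H(Q)%G; have sMN : M \subset 'N(Q) by apply: subsetIr.
have DxV: x^-1 \in H :* x * H.
  have: x^-1 \in H :* y * H.
    have: x \in H :* y^-1 * H.
      by apply: double_coset_trans Dx _; rewrite double_coset_sym.
    by rewrite -double_coset_inv inE.
  by move/double_coset_trans; apply; rewrite double_coset_sym.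
have MxV := double_coset_norm_Sylow sylQ nQx (groupVr nQx) DxV.
pose E := (M / Q)%G :* coset Q x * (M / Q)%G.
have [||e Ee ee] := @odd_invg_closed_fix _ E.
- rewrite double_coset_inv; apply: double_coset_eq; rewrite -morphV //.
  case/double_cosetP: MxV => m [m' [Mm Mm' ->]]; apply/double_cosetP.
  have [Nm Nm'] := (subsetP sMN m Mm, subsetP sMN m' Mm').
  by exists (coset Q m), (coset Q m'); rewrite !mem_quotient ?morphM ?groupM.
- have oddMQ := odd_norm_Sylow_quotient sylQ.
  by rewrite card_double_coset oddM oddMQ (dvdn_odd (dvdn_indexg _ _)).
case/double_cosetP: Ee ee => _ [_ [/morphimP[m Nm Mm ->] /morphimP[m' Nm' Mm' ->] ->]].
rewrite -!morphM ?groupM //; set z := m * x * m' => zz.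
have Dz: z \in H :* y * H.
  have [[Hm _] [Hm' _]] := (setIP Mm, setIP Mm').
  by rewrite double_coset_mulr ?double_coset_mull.
have [||t /rcosetP[q Qq ->] tt] := liftQ z.
- by rewrite inE (subsetP (double_coset_sub sHG Gy)) // !groupM.
- by apply: coset_idr zz; rewrite !groupM.
by exists (q * z); rewrite // double_coset_mull // (subsetP (pHall_sub sylQ)).
Qed.

Lemma perfect_code_Sylow2P G H Q : H \subset G -> 2.-Sylow(H) Q ->
  perfect_code G H <->
  {in 'N_G(Q), forall x, x * x \in Q -> exists2 t, t \in Q :* x & t * t = 1}.
Proof.
move=> sHG sylQ; have [pcT Tpc] := perfect_code_groupP sHG; split; last first.
  move=> liftQ; apply: Tpc; apply: sym_transversal_exists => // y Gy DyV oddD.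
  exact: double_coset_involution sHG sylQ liftQ Gy DyV oddD.
case/pcT=> T [sTG TV T1] x /setIP[Gx nQx] Qxx; have sQH := pHall_sub sylQ.
pose D := H :* x * H; have sDG: D \subset G by apply: double_coset_sub.
(* [x^-1] differs from [x] by the factor [x * x], which lies in [Q] and so in [H]. *)
have DV: D^-1 = D.
  rewrite double_coset_inv; apply: double_coset_eq.
  rewrite -(double_coset_mull _ _ (subsetP sQH _ Qxx)) -mulgA mulgV mulg1.
  exact: double_coset_refl.
(* [T] has one element in each right coset inside [D], and the number of these is the odd index of
   [H :&: H :^ x]. *)
have oddD: odd #|D :&: T|.
  have <-: #|H : H :&: H :^ x| = #|D :&: T|.
    apply/eqP; rewrite -(eqn_pmul2l (cardG_gt0 H)) -card_double_coset.
    rewrite -card_mul_coset_inj; last first.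
      move=> s t /setIP[Ds Ts] /setIP[Dt Tt] Hst.
      have /eqP/cards1P[u def_u] := T1 t (subsetP sTG t Tt).
      have: t \in T :&: H :* t by rewrite inE Tt mem_rcoset mulgV group1.
      have: s \in T :&: H :* t by rewrite inE Ts mem_rcoset.
      by rewrite def_u => /set1P-> /set1P->.
    rewrite -/D; apply/eqP; congr #|pred_of_set _|.
    apply/eqP; rewrite eqEsubset mul_sub_double_coset ?subsetIl // andbT.
    apply/subsetP=> d Dd; have Gd := subsetP sDG d Dd.
    have /card_gt0P[t]: #|T :&: H :* d| > 0 by rewrite T1.
    rewrite inE mem_rcoset => /andP[Tt Htd].
    rewrite -[d](mulKg (t * d^-1)) mulgKV mem_mulg ?groupV // inE Tt andbT.
    by rewrite -(mulgKV d t) double_coset_mull.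
  exact: index_setIJ_odd sylQ nQx.
have [|t /setIP[Dt _] tt] := odd_invg_closed_fix _ oddD.
  by rewrite -{2}DV -{2}TV; apply/setP=> z; rewrite !inE.
pose K := (H :&: H :^ t)%G.
have nKt: t \in 'N(K).
  by rewrite inE /= conjIg -conjsgM tt conjsg1 setIC.
have oddK: odd #|H : K|.
  suff ->: #|H : K| = #|H : H :&: H :^ x| by apply: index_setIJ_odd sylQ nQx.
  apply/eqP; rewrite -(eqn_pmul2l (cardG_gt0 H)) -!card_double_coset.
  by rewrite (double_coset_eq Dt).
(* A Sylow 2-subgroup of [K <*> <[t]>] containing [t] meets the normal subgroup [K] in a Sylow
   2-subgroup normalised by [t]. As [K] has odd index in [H], conjugating it to [Q] moves [t] into
   the normaliser of [Q]. *)
have [P sylP tP] : exists2 P, 2.-Sylow(K) (gval P) & t \in 'N(P).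
  have nKT: <[t]> \subset 'N(K) by rewrite cycle_subG.
  have t2: 2.-group <[t]>.
    by rewrite [2.-group _](pnat_dvd (n := 2)) // order_dvdn expgS expg1 tt.
  have [P sylP sTP] := Sylow_superset (joing_subr K <[t]>) t2.
  have Pt: t \in P by rewrite -cycle_subG.
  exists (K :&: P)%G.
    by apply: Sylow_setI_normal sylP; rewrite normalYl.
  by rewrite inE conjIg (normP nKt) conjGid.
have [h Hh defP] := Sylow_trans sylQ (Sylow2_odd_index (subsetIl _ _) oddK sylP).
pose t1 := t ^ h^-1.
have nQt1: t1 \in 'N(Q).
  by rewrite -(conjsgK h Q) -defP normJ memJ_conjg.
have Dt1: t1 \in D.
  by rewrite /t1 conjgE invgK double_coset_mull // double_coset_mulr ?groupV.
have /double_cosetP[m [m' [Mm Mm' def_t1]]] :=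
  double_coset_norm_Sylow sylQ nQx nQt1 Dt1.
have sMN : 'N_H(Q) \subset 'N(Q) by apply: subsetIr.
have [Nm Nm'] := (subsetP sMN m Mm, subsetP sMN m' Mm').
have t1m: t1 ^ m = x * (m' * m) by rewrite def_t1 conjgE !mulgA mulVg mul1g.
(* Modulo [Q], [x] and [x * (m' * m)] have square 1 and differ by an element of an odd group, so
   they are conjugate; the same conjugation brings [t1 ^ m] into [Q :* x]. *)
have [||||k] := @odd_involution_conj _ ('N_H(Q) / Q)%G (coset Q (m' * m)) (coset Q x).
- exact: odd_norm_Sylow_quotient.
- by rewrite mem_quotient ?groupM.
- by rewrite -morphM //= coset_id.
- rewrite -!morphM ?groupM // -t1m -!conjMg tt !conj1g morph1 //.
case/morphimP=> {}k Nk Mk ->; rewrite -morphM ?groupM // -t1m.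
rewrite -morphJ //; last exact: groupJ nQt1 Nm.
case/(kercoset_rcoset (groupJ (groupJ nQt1 Nm) Nk) nQx) => z Qz def_t2.
exists ((t1 ^ m) ^ k); first by rewrite def_t2 mem_rcoset mulgK.
by rewrite -!conjMg tt !conj1g.
Qed.
End SylowPerfectCodes.

(** * Groups with dihedral-like Sylow 2-subgroups *)

Section DihedralLike.

Variables (gT : finGroupType) (G : {group gT}).
Implicit Types (C P Q R : {group gT}) (t x y z : gT).

(** The model is a dihedral group, with [C] its rotations and all the reflections outside [C]. *)
Hypothesis dihedral2 : forall R, R \subset G -> 2.-group R -> R :!=: 1 ->
  exists C, [/\ C \subset R, cyclic C & {in R :\: C, forall y, y * y = 1}].
Hypothesis involution_square : forall z, z \in G -> z * z = 1 -> z != 1 ->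
  exists2 x, x \in G & x * x = z.
Lemma leq_max_cyclic_2subgroup_order C :
  C \subset G -> 2.-group C -> cyclic C -> #|C| <= max_cyclic_2subgroup_order G.
Proof.
by move=> sCG pC cC; rewrite /max_cyclic_2subgroup_order (leq_bigmax_cond C) ?sCG ?pC.
Qed.

Lemma sqr_mem_2group Q x : 2.-group Q -> x * x \in Q -> 2.-group <[x]>.
Proof.
move=> pQ Qxx; have: #[x] %| 2 * #|Q|.
  by rewrite order_dvdn expgM; apply/eqP; apply: (expg_cardG (G := Q)).
by move/pnat_dvd; apply; rewrite pnatM.
Qed.

(** Apply [dihedral2] to the 2-group generated by [Q] and [x]. A solution is any element of [Q :* x]
    outside [C]; there is none only if [C] contains both [Q] and [x]. Then [Q] is cyclic, and
    maximal order would give [Q = C], which contains [x]. *)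
Lemma noncyclic_or_max_lift Q :
    Q \subset G -> 2.-group Q ->
    [\/ Q :=: 1, ~~ cyclic Q
      | cyclic Q /\ #|Q| = max_cyclic_2subgroup_order G] ->
  {in 'N_G(Q), forall x, x * x \in Q -> exists2 t, t \in Q :* x & t * t = 1}.
Proof.
move=> sQG pQ Qcase x /setIP[Gx nQx] Qxx.
have [Qx | Q'x] := boolP (x \in Q).
  by exists 1; rewrite ?mulg1 // mem_rcoset mul1g groupV.
pose R := (Q <*> <[x]>)%G.
have sQR : Q \subset R by apply: joing_subl.
have Rx : x \in R by rewrite -cycle_subG joing_subr.
have pR : 2.-group R.
  by rewrite /R /= norm_joinEr ?cycle_subG // pgroupM pQ (sqr_mem_2group pQ Qxx).
have R1 : R :!=: 1.
  by apply: contraNneq Q'x => R1; move: Rx; rewrite R1 => /set1P->.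
have sRG : R \subset G by rewrite join_subG sQG cycle_subG.
have [C [sCR cC sqr1]] := dihedral2 sRG pR R1.
have [Cx | C'x] := boolP (x \in C); last first.
  by exists x; rewrite ?rcoset_refl ?sqr1 // inE C'x.
have [sQC | /subsetPn[y Qy C'y]] := boolP (Q \subset C); last first.
  exists (y * x); first by rewrite mem_rcoset mulgK.
  by rewrite sqr1 // inE groupMr // C'y groupM // (subsetP sQR).
case: Qcase => [Q1 | /negP[] | [_ maxQ]].
- by exists x; [apply: rcoset_refl | apply/set1P; rewrite -[[set 1]]Q1].
- exact: cyclicS cC.
case/negP: Q'x; suff -> : Q :=: C by [].
apply/eqP; rewrite eqEcard sQC maxQ leq_max_cyclic_2subgroup_order //.
  exact: subset_trans sCR sRG.
exact: pgroupS pR.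
Qed.

(** A generator of order 2 is a square by [involution_square]. Any other generator lies, along with
    a conjugate of a larger cyclic 2-subgroup, in the cyclic part of a Sylow 2-subgroup, hence is an
    even power there. *)
Lemma cyclic_2subgroup_square_generator Q :
    Q \subset G -> 2.-group Q -> Q :!=: 1 -> cyclic Q ->
    #|Q| != max_cyclic_2subgroup_order G ->
  exists2 x, x \in G & Q :=: <[x * x]>.
Proof.
move=> sQG pQ Q1 cQ Q_max; have [c defQ] := cyclicP cQ.
have Gc: c \in G by rewrite -cycle_subG -defQ.
have c1: c != 1 by rewrite -cycle_eq1 -defQ.
have [cc | cc] := eqVneq (c * c) 1.
  by have [x Gx xx] := involution_square Gc cc c1; exists x; rewrite // xx.
have [C /and3P[sCG pC cC] maxC] : exists2 C : {group gT},
    [&& C \subset G, 2.-group C & cyclic C] & max_cyclic_2subgroup_order G = #|C|.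
  pose cyclic2 (C : {group gT}) := [&& C \subset G, 2.-group C & cyclic C].
  have c2_1 : cyclic2 1%G by rewrite /cyclic2 sub1G pgroup1 cyclic1.
  have [C c2C maxC] := arg_maxnP (fun C : {group gT} => #|C|) c2_1.
  exists C => //; apply/eqP; rewrite eqn_leq; apply/andP; split.
    by apply/bigmax_leqP.
  by have [sCG pC cC] := and3P c2C; apply: leq_max_cyclic_2subgroup_order.
have ltQC: #|Q| < #|C|.
  by rewrite -maxC ltn_neqAle Q_max leq_max_cyclic_2subgroup_order.
have [P sylP sQP] := Sylow_superset sQG pQ.
have [g Gg sCgP] := Sylow_Jsub sylP sCG pC.
have [y defCg] : exists y, C :^ g = <[y]> by apply/cyclicP; rewrite cyclicJ.
have P1 : P :!=: 1.
  by apply: contraNneq Q1 => P1; rewrite -subG1 -P1.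
have [P0 [sP0P cP0 sqr1]] := dihedral2 (pHall_sub sylP) (pHall_pgroup sylP) P1.
have P0I z : z \in P -> z * z != 1 -> z \in P0.
  by move=> Pz; apply: contraR => P0'z; rewrite sqr1 // inE P0'z.
have P0c: c \in P0 by rewrite P0I // -cycle_subG -defQ.
have cardy: #[y] = #|C| by rewrite orderE -defCg cardJg.
have Py: y \in P by rewrite -cycle_subG -defCg.
have p_y : 2.-group <[y]> by rewrite -defCg pgroupJ.
have P0y: y \in P0.
  apply: P0I => //; apply/eqP=> yy.
  have: #[c] <= 2.
    rewrite orderE -defQ -ltnS; apply: leq_trans ltQC _.
    by rewrite -cardy ltnW // ltnS dvdn_leq // order_dvdn; apply/eqP.
  have := cc; rewrite -[c * c]/(c ^+ 2) -order_dvdn.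
  by case: #[c] (order_gt0 c) => [|[|[|]]].
(* In the cyclic group [P0], inclusion of subgroups is divisibility of orders, and both orders are
   powers of 2. *)
have : c \in <[y]>.
  rewrite -cycle_subG -(cardSg_cyclic cP0) ?cycle_subG // -!orderE.
  have /p_natP[i def_c] : 2.-nat #[c] by rewrite orderE -defQ.
  have /p_natP[j def_y] : 2.-nat #[y] by [].
  rewrite def_c def_y dvdn_exp2l // -(leq_exp2l _ _ (ltnSn 1)) -def_c -def_y.
  by rewrite cardy [#[c]]orderE -defQ ltnW.
case/cycleP=> k def_c.
have evenk : ~~ odd k.
  apply: contraL ltQC => oddk; rewrite -leqNgt -cardy defQ orderE.
  have : generator <[y]> (y ^+ k).
    by rewrite generator_coprime; apply: pnat_coprime p_y _; rewrite -odd_2'nat.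
  by rewrite -def_c => /eqP->.
exists (y ^+ k./2); first by rewrite groupX // (subsetP (pHall_sub sylP)).
by rewrite defQ def_c -expgD addnn even_halfK.
Qed.

(** If [Q] is generated by [x * x], then [Q :* x] consists of odd powers of the 2-element [x]. One
    of them having square 1 forces [x * x = 1], so [Q] would be trivial. *)
Lemma lift_cyclic_max Q :
    Q \subset G -> 2.-group Q -> Q :!=: 1 -> cyclic Q ->
    {in 'N_G(Q), forall x, x * x \in Q -> exists2 t, t \in Q :* x & t * t = 1} ->
  #|Q| = max_cyclic_2subgroup_order G.
Proof.
move=> sQG pQ Q1 cQ liftQ; apply/eqP; apply: contraT => Q_max.
have [x Gx defQ] := cyclic_2subgroup_square_generator sQG pQ Q1 cQ Q_max.
have Qxx: x * x \in Q by rewrite defQ cycle_id.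
have [|t] := liftQ x _ Qxx.
  have cx : <[x]> \subset 'N(Q).
    apply/cents_norm/(centsS _ (cycle_abelian x)).
    by rewrite defQ cycle_subG groupM ?cycle_id.
  by rewrite inE Gx -cycle_subG.
case/rcosetP=> q; rewrite defQ => /cycleP[i ->] -> tt.
have px : 2.-group <[x]> := sqr_mem_2group pQ Qxx.
have xx : x ^+ 2 = x * x by [].
have t_x : (x * x) ^+ i * x = x ^+ (i.*2).+1 by rewrite expgSr -mul2n expgM.
have : #[x] %| 2 * (i.*2).+1.
  by rewrite order_dvdn mulnC expgM -t_x; apply/eqP.
rewrite Gauss_dvdl; last first.
  by apply: pnat_coprime px _; rewrite -odd_2'nat /= odd_double.
rewrite order_dvdn xx => /eqP x2; case/negP: Q1.
by rewrite defQ x2 cycle1.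
Qed.

Lemma cyclic_max_lift_iff Q : Q \subset G -> 2.-group Q ->
  {in 'N_G(Q), forall x, x * x \in Q -> exists2 t, t \in Q :* x & t * t = 1} <->
  [\/ Q :=: 1, ~~ cyclic Q
    | cyclic Q /\ #|Q| = max_cyclic_2subgroup_order G].
Proof.
move=> sQG pQ; split=> [liftQ | ]; last exact: noncyclic_or_max_lift.
have [Q1 | Q1] := eqVneq (gval Q) 1; first by constructor 1.
have [cQ | ncQ] := boolP (cyclic Q); last by constructor 2.
by constructor 3; split=> //; apply: lift_cyclic_max.
Qed.

End DihedralLike.

(** * Square roots of 2 and 2 x 2 matrices *)

Section FieldTheory.

Import GRing.Theory.
Local Open Scope ring_scope.

Lemma odd_card_finField_2neq0 (F : finFieldType) : odd #|F| -> (2%:R : F) != 0.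
Proof.
move=> oddF; apply/eqP=> F2.
have: (#|F|%:R : F) == 0.
  by have := expg_cardG (in_setT (1 : F)); rewrite cardsT FinRing.zmodXgE => ->.
rewrite -(odd_double_half #|F|) oddF natrD -mul2n natrM F2 mul0r addr0.
by rewrite oner_eq0.
Qed.

(** For a primitive eighth root of unity [z] in an extension, [z + z^-1] is a square root of 2.
    Raising to the power [#|F|] fixes or swaps [z] and [z^-1], so this root lies in [F]. *)
Lemma sqrt2_exists (F : finFieldType) :
  #|F| = 1 %[mod 8] \/ #|F| = 7 %[mod 8] -> exists r : F, r * r = 2%:R.
Proof.
move=> q8; pose p : {poly F} := 'X^4 + 1.
have sizep : size p = 5 by rewrite size_polyDl size_polyXn ?size_poly1.
have nz_p : p != 0 by rewrite -size_poly_eq0 sizep.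
have [L [rs def_p _]] := FinSplittingFieldFor nz_p.
have [z pz0]: exists z : L, z ^+ 4 = -1.
  case: rs def_p => [|z rs] def_p.
    by move/eqp_size: def_p; rewrite big_nil size_poly1 size_map_poly sizep.
  exists z; apply/eqP; rewrite -subr_eq0 opprK.
  have: root (map_poly (in_alg L) p) z.
    by rewrite (eqp_root def_p) root_prod_XsubC mem_head.
  by rewrite rootE rmorphD /= map_polyXn rmorph1 !hornerE.
have z0 : z != 0.
  by apply/eqP=> z0; move/eqP: pz0; rewrite z0 expr0n /= eq_sym oppr_eq0 oner_eq0.
have z8 : z ^+ 8 = 1 by rewrite (exprM z 4 2) pz0 sqrrN expr1n.
pose s := z + z^-1.
have ss : s * s = 2%:R.
  have -> : s * s = 2%:R + z ^- 2 * (z ^+ 4 + 1) by rewrite /s; field.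
  by rewrite pz0 addNr mulr0 addr0.
have sq : s ^+ #|F| = s.
  have [q pr_q Fq] := finPcharP F.
  have qL : [pchar L].-nat #|F|.
    rewrite (eq_pnat _ (pchar_lalg L)) (eq_pnat _ (pcharf_eq Fq)) -cardsT.
    exact: abelem_pgroup (fin_ring_pchar_abelem Fq).
  rewrite exprDn_pchar // exprVn.
  rewrite (divn_eq #|F| 8); case: q8 => ->; rewrite exprD mulnC exprM z8 expr1n mul1r //.
  have z7 : z ^+ (7 %% 8) = z^-1 by apply: (mulfI z0); rewrite -exprS z8 mulfV.
  by rewrite z7 invrK addrC.
(* [s] is a root of ['X^#|F| - 'X], which is the product of the ['X - r%:P] over all [r] in [F]. *)
have := congr1 (map_poly (in_alg L)) (finField_genPoly F).
rewrite rmorphB /= map_polyXn map_polyX => /(congr1 (fun P : {poly L} => P.[s])).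
rewrite !hornerE sq subrr rmorph_prod horner_prod => /esym/eqP/prodf_eq0[r _].
rewrite rmorphB /= map_polyX map_polyC !hornerE subr_eq0 => /eqP def_s.
exists r; apply: (fmorph_inj (in_alg L)); rewrite rmorphM rmorph_nat -ss def_s //.
Qed.

Lemma ord2P (i : 'I_2) : i = 0 \/ i = 1.
Proof. by case: i => [[|[|//]] lti]; [left | right]; apply: val_inj. Qed.

Lemma sum_ord2 (V : nmodType) (f : 'I_2 -> V) : \sum_i f i = f 0 + f 1.
Proof. by rewrite !big_ord_recl big_ord0 addr0; congr (_ + f _); apply: val_inj. Qed.

(** * Trace and determinant identities for 2 x 2 matrices *)

Section Matrix2.
Variable R : comNzRingType.
Implicit Types A B : 'M[R]_2.

Lemma det_mx2 A : \det A = A 0 0 * A 1 1 - A 0 1 * A 1 0.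
Proof.
rewrite (expand_det_row _ 0) sum_ord2 /cofactor !det_mx11 !mxE.
have -> : lift (0 : 'I_2) (0 : 'I_1) = 1 by apply: val_inj.
have -> : lift (1 : 'I_2) (0 : 'I_1) = 0 by apply: val_inj.
by rewrite /= expr0 expr1; ring.
Qed.

Lemma mx2_sqr A : A * A = \tr A *: A - \det A *: 1.
Proof.
rewrite -!mulmxE; apply/matrixP=> i j; rewrite !mxE /mxtrace !sum_ord2 det_mx2.
by case: (ord2P i) => ->; case: (ord2P j) => ->; rewrite /=; ring.
Qed.

(* The polarisation of the Cayley-Hamilton identity [mx2_sqr]. *)
Lemma mx2_anticommutator A B :
  A * B + B * A = \tr A *: B + \tr B *: A + (\tr (A * B) - \tr A * \tr B) *: 1.
Proof.
rewrite -!mulmxE; apply/matrixP=> i j; rewrite !mxE /mxtrace !sum_ord2 !mxE !sum_ord2.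
by case: (ord2P i) => ->; case: (ord2P j) => ->; rewrite /=; ring.
Qed.

End Matrix2.

Section OddField.

Variable F : fieldType.
Hypothesis two_neq0 : (2%:R : F) != 0.
Implicit Types A B : 'M[F]_2.

Lemma mx2_sqr1 A : \det A = 1 -> A * A = 1 -> exists a, A = a *: 1.
Proof.
move=> detA AA; exists (2%:R / \tr A).
have tA : \tr A *: A = 2%:R *: 1.
  by apply/eqP; rewrite scaler_nat -subr_eq -{2}AA mx2_sqr detA scale1r.
have trA : \tr A != 0.
  apply/eqP=> trA; move/eqP: tA; rewrite trA scale0r eq_sym scaler_eq0.
  by rewrite (negPf two_neq0) oner_eq0.
by rewrite mulrC -scalerA -tA scalerA mulVf ?scale1r.
Qed.

Lemma mx2_sqrN1_trace A : \det A = 1 -> A * A = -1 -> \tr A = 0.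
Proof.
move=> detA AA; apply/eqP; have := mx2_sqr A; rewrite AA detA scale1r => /eqP.
rewrite eq_sym -subr_eq0 opprK subrK scaler_eq0 => /orP[] // /eqP A0.
by move/eqP: AA; rewrite A0 mul0r eq_sym oppr_eq0 oner_eq0.
Qed.

(** Since [A] has trace 0, the polarised identity expresses [2 A B] through [1] and [A]; multiplying
    by [A], whose square is -1, isolates [B]. *)
Lemma mx2_commute_sqrN1 A B : \det A = 1 -> A * A = -1 -> A * B = B * A ->
  exists a b, B = a *: 1 + b *: A.
Proof.
move=> detA AA cAB; have trA := mx2_sqrN1_trace detA AA.
exists (\tr B / 2%:R), (- (\tr (A * B) / 2%:R)).
have := mx2_anticommutator A B.
rewrite -cAB trA scale0r add0r mul0r subr0 -mulr2n => /(congr1 (fun M => A * M)).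
rewrite mulrnAr mulrA AA mulN1r mulrDr -!scalerAr AA mulr1 => eqB.
have {}eqB : 2%:R *: B = \tr B *: 1 - \tr (A * B) *: A.
  by rewrite scaler_nat -[LHS]opprK -mulNrn eqB scalerN opprD opprK.
by rewrite scaleNr 2![_ / _]mulrC -!scalerA -scalerBr -eqB scalerA mulVf ?scale1r.
Qed.

(** Anticommutation and the symmetry of the trace give [\tr (A * B) = 0]. The polarised identity
    then reduces to [\tr B *: A = 0], so [B] has trace 0 and Cayley-Hamilton concludes. *)
Lemma mx2_anticommute_sqr A B : \det A = 1 -> \det B = 1 -> A * A = -1 ->
  A * B = - (B * A) -> B * B = -1.
Proof.
move=> detA detB AA aAB; have trA := mx2_sqrN1_trace detA AA.
have trAB : \tr (A * B) = 0.
  have : \tr (A * B) *+ 2 = 0.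
    by rewrite mulr2n {1}aAB raddfN /= -!mulmxE mxtrace_mulC addNr.
  by move/eqP; rewrite -mulr_natl mulf_eq0 (negPf two_neq0) => /eqP.
have := mx2_anticommutator A B.
rewrite aAB addNr trA raddfN /= mul0r subr0 -mulmxE mxtrace_mulC mulmxE trAB.
rewrite oppr0 !scale0r add0r addr0 => /esym/eqP; rewrite scaler_eq0 => /orP[] /eqP E.
  by rewrite mx2_sqr E detB scale0r scale1r add0r.
by move/eqP: AA; rewrite E mul0r eq_sym oppr_eq0 oner_eq0.
Qed.

Lemma mx2_sqrt A (r : F) : r * r = 2%:R -> \det A = 1 -> A * A = -1 ->
  exists2 B, \det B = 1 & B * B = A.
Proof.
move=> rr detA AA; have trA := mx2_sqrN1_trace detA AA.
have r0 : r != 0 by apply: contraNneq two_neq0 => r0; rewrite -rr r0 mul0r.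
(* [(1 + A)^2 = 2 A] because [A * A = -1], and [1 + A] has determinant [1 + \tr A + \det A = 2];
   dividing by [r] normalises both. *)
exists (r^-1 *: (1 + A)); last first.
  rewrite -scalerAl -scalerAr scalerA -invfM rr mulrDl !mulrDr AA !mul1r mulr1.
  rewrite [1 + A]addrC addrACA subrr addr0 -mulr2n -scaler_nat scalerA.
  by rewrite mulVf ?scale1r.
have -> : \det (r^-1 *: (1 + A)) = (r * r)^-1 * (1 + \tr A + \det A).
  rewrite detZ !det_mx2 /mxtrace sum_ord2 !mxE /= !mulr1n !mulr0n.
  by field.
by rewrite rr trA detA addr0 mulVf.
Qed.

End OddField.

End FieldTheory.

(** * The 2-subgroups of PSL(2,q) *)

Section PSL2.

Variable F : finFieldType.
Hypothesis two_neq0 : (2%:R : F)%R != 0%R.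

Local Notation SL := (SL2 F).
Local Notation Z := 'Z(SL2 F).
Implicit Types (u v w : {'GL_2[F]}).

Lemma SL2_det u : u \in SL -> (\det (GLval u) = 1)%R.
Proof. by rewrite inE => /eqP. Qed.

Lemma SL2_lift (A : 'M[F]_2) : (\det A = 1)%R -> exists2 u, u \in SL & GLval u = A.
Proof.
move=> detA; have UA : A \is a GRing.unit
  by rewrite -[_ \is a _]/(A \in unitmx) unitmxE detA GRing.unitr1.
by exists (Sub A UA : {'GL_2[F]}); rewrite ?inE ?SubK // detA.
Qed.

Lemma GLval_inj2 u v : GLval u = GLval v -> u = v.
Proof. exact: val_inj. Qed.

Lemma scalar_SL2 u (a : F) :
  u \in SL -> GLval u = (a *: 1)%R -> GLval u = 1%R \/ GLval u = (-1)%R.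
Proof.
move=> SLu def_u; have := SL2_det SLu; rewrite def_u => /eqP.
rewrite detZ det1 GRing.mulr1 GRing.sqrf_eq1 => /orP[] /eqP->.
  by left; rewrite GRing.scale1r.
by right; rewrite GRing.scaleN1r.
Qed.

Lemma SL2_centerP u :
  u \in SL -> reflect (GLval u = 1%R \/ GLval u = (-1)%R) (u \in Z).
Proof.
move=> SLu; apply: (iffP idP) => [/centerP[_ cu] | uE]; last first.
  apply/centerP; split=> // v _; apply: GLval_inj2; rewrite !GL_ME.
  by case: uE => ->; rewrite ?GRing.mulr1 ?GRing.mul1r ?GRing.mulrN1 ?GRing.mulN1r.
(* Commuting with the two elementary transvections already forces a matrix to be scalar. *)
pose E (i j : 'I_2) : 'M[F]_2 := (1 + delta_mx i j)%R.
have cE i j : i != j -> (GLval u *m delta_mx i j = delta_mx i j *m GLval u)%R.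
  move=> nij; have detE : (\det (E i j) = 1)%R.
    rewrite det_mx2 !mxE; move: nij.
    by case: (ord2P i) => ->; case: (ord2P j) => -> //= _; ring.
  have [v SLv def_v] := SL2_lift detE.
  have := congr1 (@GLval _ _) (cu v SLv); rewrite !GL_ME def_v /E.
  by rewrite GRing.mulrDr GRing.mulrDl GRing.mulr1 GRing.mul1r => /GRing.addrI.
have c01 := cE 0%R 1%R isT; have c10 := cE 1%R 0%R isT.
apply: (@scalar_SL2 _ (GLval u 0 0)%R SLu).
have e00 := congr1 (fun M : 'M_2 => M 0 1)%R c01.
have e01 := congr1 (fun M : 'M_2 => M 0 0)%R c01.
have e10 := congr1 (fun M : 'M_2 => M 0 0)%R c10.
move: e00 e01 e10; rewrite !mxE !sum_ord2 !mxE /=.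
rewrite !(GRing.mulr0, GRing.mul0r, GRing.mulr1, GRing.mul1r, GRing.addr0, GRing.add0r).
move=> e00 e01 e10; apply/matrixP=> i j; rewrite !mxE.
by case: (ord2P i) => ->; case: (ord2P j) => ->; rewrite /= ?GRing.mulr1 ?GRing.mulr0.
Qed.

Lemma SL2_sqr_center u : u \in SL -> u * u \in Z ->
  u \in Z \/ (GLval u * GLval u = -1)%R.
Proof.
move=> SLu /(SL2_centerP (groupM SLu SLu)).
rewrite GL_ME => -[uu | uu]; [left | by right].
apply/SL2_centerP => //; have [a def_u] := mx2_sqr1 two_neq0 (SL2_det SLu) uu.
exact: scalar_SL2 def_u.
Qed.

Lemma mx_sqr1N1 (A : 'M[F]_2) : (A = 1 -> A = -1 -> False)%R.
Proof.
move=> -> /eqP; rewrite -GRing.subr_eq0 GRing.opprK -[(1 + 1)%R]/(1 *+ 2)%R.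
by rewrite -GRing.scaler_nat GRing.scaler_eq0 (negPf two_neq0) GRing.oner_eq0.
Qed.

Lemma SL2_normZ u : u \in SL -> u \in 'N(Z).
Proof. by apply: subsetP; apply: gFnorm. Qed.

Lemma PSL2_lift x : x \in PSL2 F -> exists2 u, u \in SL & x = coset Z u.
Proof. by case/morphimP=> u _ SLu ->; exists u. Qed.

Lemma PSL2_coset u : u \in SL -> coset Z u \in PSL2 F.
Proof. exact: mem_quotient. Qed.

Lemma SL2_coset1 u : u \in SL -> coset Z u = 1 -> u \in Z.
Proof. by move=> SLu; apply: coset_idr; apply: SL2_normZ. Qed.

Lemma SL2_cosetM u v : u \in SL -> v \in SL -> coset Z (u * v) = coset Z u * coset Z v.
Proof. by move=> SLu SLv; rewrite morphM ?SL2_normZ. Qed.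

Lemma PSL2_involution_lift z : z \in PSL2 F -> z * z = 1 -> z != 1 ->
  exists u, [/\ u \in SL, z = coset Z u & (GLval u * GLval u = -1)%R].
Proof.
move=> /PSL2_lift[u SLu ->]; rewrite -SL2_cosetM // => uu u1; exists u; split=> //.
have [Zu | uuN1] := SL2_sqr_center SLu (SL2_coset1 (groupM SLu SLu) uu).
  by rewrite coset_id ?eqxx in u1.
exact: uuN1.
Qed.

Lemma SL2_sqrN1_coset u : u \in SL -> (GLval u * GLval u = -1)%R ->
  coset Z u * coset Z u = 1.
Proof.
move=> SLu uu; rewrite -SL2_cosetM // coset_id //.
by apply/SL2_centerP; rewrite ?groupM // GL_ME; right.
Qed.

Lemma PSL2_involution_square (r : F) : (r * r = 2%:R)%R ->
  forall z, z \in PSL2 F -> z * z = 1 -> z != 1 ->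
  exists2 x, x \in PSL2 F & x * x = z.
Proof.
move=> rr z Gz zz z1; have [u [SLu -> uu]] := PSL2_involution_lift Gz zz z1.
have [B detB BB] := mx2_sqrt two_neq0 rr (SL2_det SLu) uu.
have [v SLv def_v] := SL2_lift detB.
exists (coset Z v); first exact: PSL2_coset.
by rewrite -SL2_cosetM //; congr (coset _ _); apply: GLval_inj2; rewrite GL_ME def_v.
Qed.

(** The centraliser lies in the commutative algebra spanned by [1] and [u]. *)
Lemma cent1_sqrN1_abelian u : u \in SL -> (GLval u * GLval u = -1)%R ->
  abelian 'C_SL[u].
Proof.
move=> SLu uu; have form v : v \in 'C_SL[u] ->
    exists a b : F, (GLval v = a *: 1 + b *: GLval u)%R.
  case/setIP=> SLv /cent1P cuv.
  apply: (mx2_commute_sqrN1 two_neq0 (SL2_det SLu) uu).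
  by have := congr1 (@GLval _ _) cuv; rewrite !GL_ME => ->.
apply/centsP=> v Cv w Cw; apply: GLval_inj2; rewrite !GL_ME.
have [[a [b ->]] [c [d ->]]] := (form v Cv, form w Cw).
rewrite !GRing.mulrDl !GRing.mulrDr -!GRing.scalerAl -!GRing.scalerAr !GRing.scalerA.
rewrite !GRing.mul1r !GRing.mulr1 [RHS]GRing.addrACA.
by rewrite (GRing.mulrC c) (GRing.mulrC d a) (GRing.mulrC c b) (GRing.mulrC d b).
Qed.

Lemma PSL2_dihedral2 (R : {group coset_of Z}) :
    R \subset PSL2 F -> 2.-group R -> R :!=: 1 ->
  exists C : {group coset_of Z},
    [/\ C \subset R, cyclic C & {in R :\: C, forall y, y * y = 1}].
Proof.
move=> sRG pR R1.
have Z1 : 'Z(R) != 1 by apply: contra R1 => /eqP/(trivg_center_pgroup pR)->.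
have [_ dvd2 _] := pgroup_pdiv (pgroupS (center_sub R) pR) Z1.
have [z Zz oz] := Cauchy (isT : prime 2) dvd2.
have [Rz cRz]: z \in R /\ centralises z R by apply/centerP.
have Gz := subsetP sRG z Rz.
have z1 : z != 1 by rewrite -order_eq1 oz.
have zz : z * z = 1 by have := expg_order z; rewrite oz.
have [u [SLu def_z uu]] := PSL2_involution_lift Gz zz z1.
have abC := cent1_sqrN1_abelian SLu uu.
pose C := (R :&: 'C_SL[u] / Z)%G; exists C; split; first exact: subsetIl.
  have pC : 2.-group C := pgroupS (subsetIl _ _) pR.
  have abelC : abelian C.
    by apply: abelianS (subsetIr _ _) _; apply: quotient_abelian.
  (* An abelian 2-group is cyclic once its elements of square 1 lie in a cyclic group, here
     [<[z]>]. *)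
  rewrite abelian_rank1_cyclic // -rank_Ohm1.
  have : 'r(<[z]>) <= 1 by rewrite -abelian_rank1_cyclic ?cycle_cyclic ?cycle_abelian.
  apply: leq_trans; apply: rankS; rewrite (OhmE 1 pC) gen_subG.
  apply/subsetP=> y; rewrite !inE => /andP[/andP[Ry]].
  case/morphimP=> w _ /setIP[SLw /cent1P cuw] -> /= /eqP ww.
  have [->|w1] := eqVneq (coset Z w) 1; first exact: group1.
  have {}ww : coset Z w * coset Z w = 1 by [].
  have wwN1 : (GLval w * GLval w = -1)%R.
    move: ww; rewrite -SL2_cosetM // => /(SL2_coset1 (groupM SLw SLw)).
    case/(SL2_sqr_center SLw) => [Zw | wwN1]; last exact: wwN1.
    by rewrite coset_id ?eqxx in w1.
  (* The lifts [u] and [w] commute and both square to -1, so [u * w] squares to 1 and is central;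
     hence [w] and [u^-1] have the same image. *)
  have uwuw : (GLval (u * w) * GLval (u * w) = 1)%R.
    have uwuw : (u * w) * (u * w) = (u * u) * (w * w).
      by rewrite -mulgA (mulgA w) (cuw : w * u = u * w) !mulgA.
    rewrite -GL_ME uwuw !GL_ME uu wwN1.
    by rewrite GRing.mulrNN GRing.mulr1.
  have SLuw : u * w \in SL by rewrite groupM.
  have Zuwuw : (u * w) * (u * w) \in Z.
    by apply/(SL2_centerP (groupM SLuw SLuw)); left; rewrite GL_ME.
  have Zuw : u * w \in Z.
    by have [Zuw | uwN1] := SL2_sqr_center SLuw Zuwuw; last case: (mx_sqr1N1 uwuw uwN1).
  have : z * coset Z w = 1 by rewrite def_z -SL2_cosetM // coset_id.
  by move/eqP; rewrite -eq_invg_mul => /eqP<-; rewrite groupV cycle_id.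
move=> y /setDP[Ry C'y]; have [w SLw def_y] := PSL2_lift (subsetP sRG y Ry).
(* [z] is central in [R], so the lifts commute up to sign. The sign +1 would put [y] in [C]; the
   sign -1 is anticommutation. *)
have cwu : [~ u, w] \in Z.
  apply: SL2_coset1; first by rewrite groupR.
  rewrite morphR ?SL2_normZ //= -def_z -def_y; apply/eqP/commgP.
  exact: cRz.
have uw : u * w = w * u * [~ u, w] by rewrite commgC.
have [c1 | cN1] := SL2_centerP (groupR SLu SLw) cwu.
  case/negP: C'y; rewrite inE Ry def_y mem_quotient // inE SLw.
  have {}c1 : [~ u, w] = 1 by apply: GLval_inj2; rewrite c1.
  by apply/cent1P; rewrite /commute uw c1 mulg1.
rewrite def_y SL2_sqrN1_coset //.
apply: (mx2_anticommute_sqr two_neq0 (SL2_det SLu) (SL2_det SLw) uu).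
have := congr1 (@GLval _ _) uw.
by rewrite (GL_ME u w) (GL_ME (w * u)) (GL_ME w u) cN1 GRing.mulrN1.
Qed.

End PSL2.

Theorem theorem4p3 (q : nat) (F : finFieldType) (cardF : #|F| = q)
    (q_mod8 : q = 1 %[mod 8] \/ q = 7 %[mod 8])
    (H Q : {group coset_of 'Z(SL2 F)})
    (sHG : H \subset PSL2 F) (sylQ : 2.-Sylow(H) Q) :
  perfect_code (PSL2 F) H <->
  [\/ Q :=: 1, ~~ cyclic Q
    | cyclic Q /\ #|Q| = max_cyclic_2subgroup_order (PSL2 F)].
Proof.
rewrite -cardF in q_mod8; have [r rr] := sqrt2_exists q_mod8.
have two_neq0 : (2%:R : F)%R != 0%R.
  apply: odd_card_finField_2neq0; rewrite (divn_eq #|F| 8) oddD oddM andbF.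
  by case: q_mod8 => ->.
have sQG := subset_trans (pHall_sub sylQ) sHG.
apply: iff_trans (perfect_code_Sylow2P sHG sylQ) _.
apply: cyclic_max_lift_iff sQG (pHall_pgroup sylQ).
  exact: PSL2_dihedral2.
exact: PSL2_involution_square rr.
Qed.
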